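(* Every effect algebra $\mathbf P=(P,\oplus,0,1)$ is a paraorthomodular poset; that is, the bounded poset with antitone involution $(P,\leq,{}',0,1)$ induced by $\mathbf P$ is paraorthomodular.
   Context: An effect algebra is a partial algebra $(E,\oplus,0,1)$ of type $(2,0,0)$ such that for all $x,y,z\in E$: (E1) if $x\oplus y$ exists, so does $y\oplus x$, and $x\oplus y=y\oplus x$; (E2) if $x\oplus y$ and $(x\oplus y)\oplus z$ exist, so do $y\oplus z$ and $x\oplus(y\oplus z)$, and $(x\oplus y)\oplus z=x\oplus(y\oplus z)$; (E3) there exists a unique $x'\in E$ such that $x\oplus x'$ is defined and $x\oplus x'=1$; (E4) if $x\oplus1$ exists then $x=0$. The induced order is: $a\leq b$ iff there is $c\in E$ such that $a\oplus c$ exists and $a\oplus c=b$. It is well known that $(E,\leq,{}',0,1)$ is a bounded poset with an antitone involution ($x''=x$, and $x\leq y$ implies $y'\leq x'$). A bounded poset $(P,\leq,{}',0,1)$ with an antitone involution is paraorthomodular if for all $x,y\in P$: $x\leq y$ and $L(x',y)=\{0\}$ imply $x=y$, where $L(a,b)=\{z\in P\mid z\leq a\text{ and }z\leq b\}$. *)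

(* Defs.v *)
From Stdlib Require Export Relations.Relation_Definitions Sets.Ensembles.
From Stdlib Require Export Logic.IndefiniteDescription.

(* The partial operation is option-valued: [oplus x y = Some z] reads
   "x (+) y is defined and equal to z". *)
Record EffectAlgebra : Type := {
  carrier :> Type;
  oplus : carrier -> carrier -> option carrier;
  zero : carrier;
  one : carrier;
  oplus_comm : forall x y s,
    oplus x y = Some s -> oplus y x = Some s;
  oplus_assoc : forall x y z s t,
    oplus x y = Some s -> oplus s z = Some t ->
    exists r, oplus y z = Some r /\ oplus x r = Some t;
  oplus_compl : forall x, exists! x', oplus x x' = Some one;
  oplus_one : forall x s, oplus x one = Some s -> x = zero
}.

Arguments oplus {_} _ _.
Arguments zero {_}.
Arguments one {_}.

Definition compl {E : EffectAlgebra} (x : E) : E :=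
  proj1_sig (constructive_indefinite_description _ (oplus_compl E x)).

Definition ea_le {E : EffectAlgebra} (a b : E) : Prop :=
  exists c, oplus a c = Some b.

Record BoundedInvolutionPoset (P : Type) (le : relation P) (inv : P -> P)
    (bot top : P) : Prop := {
  bip_order : order P le;
  bip_bot : forall x, le bot x;
  bip_top : forall x, le x top;
  bip_invK : forall x, inv (inv x) = x;
  bip_antitone : forall x y, le x y -> le (inv y) (inv x)
}.

Definition lower_cone {P : Type} (le : relation P) (a b : P) : Ensemble P :=
  fun z => le z a /\ le z b.

Record ParaorthomodularPoset (P : Type) (le : relation P) (inv : P -> P)
    (bot top : P) : Prop := {
  pom_poset : BoundedInvolutionPoset P le inv bot top;
  pom_eq : forall x y, le x y ->
    Same_set P (lower_cone le (inv x) y) (Singleton P bot) -> x = y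
}.

(* Main.v *)
Require Import Defs.

(** The idea is that [x <= y] always provides a difference [c] with
    [x (+) c = y], and this difference lies below both [y] and [x']: from
    [(x (+) c) (+) y' = 1] associativity gives [x (+) (c (+) y') = 1], so
    [c (+) y' = x'] by uniqueness of complements.  If [x'] and [y] have only
    [0] as a common lower bound, then [c = 0], that is [x = y].

    The same regrouping gives antitonicity of the complement (the difference
    of [x'] and [y'] is again [c]).  The order axioms rest on neutrality of
    [0], cancellation and positivity, each obtained by completing a sum
    to [1] and using either uniqueness of complements or (E4). *)

Section EffectAlgebraTheory.

Variable E : EffectAlgebra.
Implicit Types a b c x y s : E.

Lemma oplus_complr x : oplus x (compl x) = Some one.
Proof.
  unfold compl.
  destruct (constructive_indefinite_description _ _) as [x' [Hx' Huniq]].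
  exact Hx'.
Qed.

Lemma compl_unique x y : oplus x y = Some one -> compl x = y.
Proof.
  intros Hxy.
  destruct (oplus_compl E x) as [z [_ Huniq]].
  rewrite <- (Huniq _ (oplus_complr x)).
  now apply Huniq.
Qed.

Lemma compl_invol x : compl (compl x) = x.
Proof. apply compl_unique, oplus_comm, oplus_complr. Qed.

Lemma oplus_one_zero : oplus (one : E) zero = Some one.
Proof.
  rewrite <- (oplus_one E _ _ (oplus_comm E _ _ _ (oplus_complr one))).
  apply oplus_complr.
Qed.

(** Adding [0] to [x' (+) x = 1] leaves [1] unchanged, so [x (+) 0] is a
    complement of [x'], as is [x]. *)
Lemma oplus_zeror x : oplus x zero = Some x.
Proof.
  pose proof (oplus_comm E _ _ _ (oplus_complr x)) as Hx.
  destruct (oplus_assoc E _ _ _ _ _ Hx oplus_one_zero) as [r [Hr Hr1]].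
  now rewrite Hr, <- (compl_unique _ _ Hr1), compl_invol.
Qed.

Lemma oplus_zerol x : oplus zero x = Some x.
Proof. apply oplus_comm, oplus_zeror. Qed.

(** Since [(a (+) b) (+) s' = 1], the element [b] is the complement of
    [a (+) s'], which does not depend on [b]. *)
Lemma oplus_cancel a b c s :
  oplus a b = Some s -> oplus a c = Some s -> b = c.
Proof.
  intros Hb%oplus_comm Hc%oplus_comm.
  destruct (oplus_assoc E _ _ _ _ _ Hb (oplus_complr s)) as [r [Hr Hbr]].
  destruct (oplus_assoc E _ _ _ _ _ Hc (oplus_complr s)) as [q [Hq Hcq]].
  assert (r = q) as <- by congruence.
  apply oplus_comm in Hbr, Hcq.
  now rewrite <- (compl_unique _ _ Hbr), <- (compl_unique _ _ Hcq).
Qed.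

(** If [b (+) a = 0] then [(b (+) a) (+) 1] is defined, hence so is
    [a (+) 1], and (E4) applies. *)
Lemma oplus_eq_zero a b : oplus a b = Some zero -> a = zero.
Proof.
  intros Hba%oplus_comm.
  destruct (oplus_assoc E _ _ _ _ _ Hba (oplus_zerol one)) as [r [Hr _]].
  exact (oplus_one E _ _ Hr).
Qed.

Lemma ea_le_order : order E (@ea_le E).
Proof.
  split.
  - intros x. exists zero. apply oplus_zeror.
  - intros x y z [c Hc] [d Hd].
    destruct (oplus_assoc E _ _ _ _ _ Hc Hd) as [r [_ Hr]].
    now exists r.
  - intros x y [c Hc] [d Hd].
    destruct (oplus_assoc E _ _ _ _ _ Hc Hd) as [r [Hcd Hr]].
    rewrite (oplus_cancel _ _ _ _ Hr (oplus_zeror x)) in Hcd.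
    rewrite (oplus_eq_zero _ _ Hcd), oplus_zeror in Hc.
    congruence.
Qed.

(** The regrouping [x (+) (c (+) y') = (x (+) c) (+) y' = 1]: the difference
    of [y] and [x] is also the difference of [x'] and [y']. *)
Lemma oplus_diff_compl x c y :
  oplus x c = Some y -> oplus c (compl y) = Some (compl x).
Proof.
  intros Hc.
  destruct (oplus_assoc E _ _ _ _ _ Hc (oplus_complr y)) as [r [Hr Hxr]].
  now rewrite Hr, (compl_unique _ _ Hxr).
Qed.

Lemma ea_bounded_involution_poset :
  BoundedInvolutionPoset E (@ea_le E) (@compl E) zero one.
Proof.
  split.
  - exact ea_le_order.
  - intros x. exists x. apply oplus_zerol.
  - intros x. exists (compl x). apply oplus_complr.
  - exact compl_invol.
  - intros x y [c Hc]. exists c.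
    now apply oplus_comm, oplus_diff_compl.
Qed.

Lemma diff_in_lower_cone x c y :
  oplus x c = Some y -> lower_cone (@ea_le E) (compl x) y c.
Proof.
  intros Hc. split.
  - exists (compl y). now apply oplus_diff_compl.
  - exists x. now apply oplus_comm.
Qed.

End EffectAlgebraTheory.

Theorem proposition2p9 (P : EffectAlgebra) :
  ParaorthomodularPoset P (@ea_le P) (@compl P) zero one.
Proof.
  split.
  - apply ea_bounded_involution_poset.
  - intros x y [c Hc] [Hcone _].
    destruct (Hcone _ (diff_in_lower_cone _ _ _ _ Hc)).
    rewrite oplus_zeror in Hc.
    congruence.
Qed.
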